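(* Suppose $\mathcal H=\mathbb C^n$ and $1<p,q<\infty$ with $\frac1p+\frac1q=1$. If $f,g\in\mathcal L_{\mathcal H}(X,\nu)$ are such that $f^p,g^q\in L^1_{\mathcal H}(X,\nu)$, $f,g\ge 0$ and $fg=gf$, then $fg\in L^1_{\mathcal H}(X,\nu)$ and $$\|fg\|_1\le \|f^p\|_1^{1/p}\,\|g^q\|_1^{1/q}.$$
   Context: Setting. $\mathcal H=\mathbb C^n$, $X$ is a locally compact Hausdorff space, and $\mathcal O(X)$ is the Borel $\sigma$-algebra of $X$. $\mathcal S(\mathcal H)$ is the set of positive trace-one operators in $\mathcal B(\mathcal H)$. $\nu:\mathcal O(X)\to\mathcal B(\mathcal H)$ is a positive operator-valued measure (POVM): $\nu(E)\ge 0$ for all $E$, and $\nu$ is countably additive on disjoint Borel sets. Fix a full-rank $\rho\in\mathcal S(\mathcal H)$ and put $\nu_\rho(E)=\operatorname{Tr}(\rho\,\nu(E))$, a finite positive measure mutually absolutely continuous with $\nu$. For an orthonormal basis $\{e_i\}$ put $\nu_{ij}(E)=\langle\nu(E)e_j,e_i\rangle$ and $\frac{d\nu}{d\nu_\rho}=\big[\frac{d\nu_{ij}}{d\nu_\rho}\big]_{i,j}$, which is positive a.e. ''Almost everywhere'' means with respect to $\nu$, equivalently $\nu_\rho$. A quantum random variable is a Borel measurable $f:X\to\mathcal B(\mathcal H)$ (i.e. $x\mapsto\operatorname{Tr}(sf(x))$ is Borel for every $s\in\mathcal S(\mathcal H)$). $\mathcal L_{\mathcal H}(X,\nu)$ is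 the linear span of the positive quantum random variables. For $s\in\mathcal S(\mathcal H)$ set $f_s(x)=\operatorname{Tr}\big(s(\tfrac{d\nu}{d\nu_\rho}(x))^{1/2}f(x)(\tfrac{d\nu}{d\nu_\rho}(x))^{1/2}\big)$. For $f\in\mathcal L_{\mathcal H}(X,\nu)$ let $Pos_f$ be the set of $(f_1,f_2,f_3,f_4)\in\mathcal L_{\mathcal H}(X,\nu)^4$ with all $f_i\ge 0$ and $f=f_1-f_2+if_3-if_4$, and define $$\|f\|_1=\inf_{Pos_f}\ \sup_{s\in\mathcal S(\mathcal H)}\int_X (f_1+f_2+f_3+f_4)_s\,d\nu_\rho\in[0,\infty].$$ $L^1_{\mathcal H}(X,\nu)$ is $\{f\in\mathcal L_{\mathcal H}(X,\nu):\|f\|_1<\infty\}$ modulo $\{f:\|f\|_1=0\}$; a function is said to lie in it when its $\|\cdot\|_1$ is finite. Products, powers (functional calculus), commutation and positivity of functions are pointwise (a.e.). *)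

(* Defs.v *)
From HB Require Import structures.
From mathcomp Require Import all_boot all_order all_algebra.
From mathcomp Require Import all_classical all_reals all_analysis.
From mathcomp Require Import complex.

Set Implicit Arguments.
Unset Strict Implicit.
Unset Printing Implicit Defensive.

Import Order.TTheory GRing.Theory Num.Theory.
Import numFieldNormedType.Exports.

Local Open Scope classical_set_scope.
Local Open Scope ring_scope.
Local Open Scope charge_scope.
Local Open Scope sesquilinear_scope.
Local Open Scope complex_scope.

(* The name is needed: the norm topology is attached to variables and constants
   of type numClosedFieldType, and is not inferred on the bare type R[i]. *)
Definition Cx (R : realType) : numClosedFieldType := R[i].

Notation borel X := (g_sigma_algebraType (@open X)).

(* A measurable type of the library is pointed, hence the pointed space X below.
   Operators on C^n are their matrices in an orthonormal basis (e_i), acting on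
   column vectors, so that <A e_j, e_i> = A i j and <A v, v> = v^* A v. *)

(* In the order of R[i], 0 <= z says that z is real and nonnegative. *)
Definition psd (R : realType) n (A : 'M[Cx R]_n) : Prop :=
  forall v : 'cV[Cx R]_n, 0 <= (v ^t* *m A *m v) 0 0.

Record state (R : realType) n := State {
  state_mx :> 'M[Cx R]_n ;
  state_psd : psd state_mx ;
  state_tr : \tr state_mx = 1 }.

(* Only the values on Borel sets matter. *)
Record povm (R : realType) n (X : ptopologicalType) := Povm {
  povm_fun :> set (borel X) -> 'M[Cx R]_n ;
  povm_psd : forall E, measurable E -> psd (povm_fun E) ;
  povm_sigma_additive : forall F : (set (borel X))^nat,
    (forall k, measurable (F k)) -> trivIset setT F ->
    (fun m => \sum_(0 <= k < m) povm_fun (F k)) @ \oo -->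
      povm_fun (\bigcup_k F k) }.

(* Continuous functional calculus for t |-> t ^ r on psd matrices. Matrices that
   are not psd, which are only met on null sets, are sent to 0. *)
Definition mxpow (R : realType) n (A : 'M[Cx R]_n) (r : R) : 'M[Cx R]_n :=
  if `[< psd A >] then
    invmx (spectralmx A)
      *m diag_mx (map_mx (fun z : Cx R => (complex.Re z `^ r)%:C : Cx R)
                         (spectral_diag A))
      *m spectralmx A
  else 0.

Section Components.
Context (R : realType) (n : nat) (X : ptopologicalType) (nu : povm R n X).

(* nu_ij is split into two signed measures because the library's
   Radon-Nikodym theorem is for real-valued charges. *)
Definition nuRe (i j : 'I_n) (E : set (borel X)) : \bar R :=
  (complex.Re (nu E i j))%:E.
Definition nuIm (i j : 'I_n) (E : set (borel X)) : \bar R :=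
  (complex.Im (nu E i j))%:E.

(* The trace is real. The library requires a measure to be nonnegative on every
   set, so the value off the Borel sets has to be fixed. *)
Definition nurho (rho : state R n) (E : set (borel X)) : \bar R :=
  if `[< measurable E >] then (complex.Re (\tr (rho *m nu E)))%:E else 0%E.

End Components.

Section Facts.
Context (R : realType).

Lemma ReD (z w : Cx R) : complex.Re (z + w) = complex.Re z + complex.Re w.
Proof. by case: z w => [a b] [c d]. Qed.

Lemma ImD (z w : Cx R) : complex.Im (z + w) = complex.Im z + complex.Im w.
Proof. by case: z w => [a b] [c d]. Qed.

Lemma normRe (z : Cx R) : `|complex.Re z|%:C <= `|z|.
Proof.
case: z => a b; rewrite lecR /= -sqrtr_sqr; apply: ler_wsqrtr.
by rewrite lerDl sqr_ge0.
Qed.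

Lemma normIm (z : Cx R) : `|complex.Im z|%:C <= `|z|.
Proof.
case: z => a b; rewrite lecR /= -sqrtr_sqr; apply: ler_wsqrtr.
by rewrite lerDr sqr_ge0.
Qed.

Lemma contract_cont (h : Cx R -> R) : (forall z w, h (z + w) = h z + h w) ->
  (forall z, `|h z|%:C <= `|z|) -> continuous (h : Cx R -> R).
Proof.
move=> hD hle z.
have Fz : Filter (nbhs (z : Cx R)) by exact: nbhs_filter.
apply/(@cvgrPdist_lt _ _ _ _ Fz) => e e0.
have e0' : (0 : Cx R) < e%:C by rewrite ltcR.
have : \forall w \near nbhs (z : Cx R), `|z - w| < e%:C.
  exact: (@cvgr_dist_lt _ _ _ _ Fz id z).
apply: filterS => w zwe.
have hB : h z - h w = h (z - w).
  by apply/eqP; rewrite subr_eq -hD subrK.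
rewrite hB -ltcR; apply: le_lt_trans (hle _) zwe.
Qed.

End Facts.

Section PovmFacts.
Context (R : realType) (n : nat) (X : ptopologicalType) (nu : povm R n X).

Lemma comp_sigma_additive (h : 'M[Cx R]_n -> R) :
  (forall A B, h (A + B) = h A + h B) -> continuous h ->
  semi_sigma_additive (fun E => (h (nu E))%:E).
Proof.
move=> hD hc F mF tF mUF.
have h0 : h 0 = 0 by apply: (addrI (h 0)); rewrite -hD !addr0.
have -> : (fun m => \sum_(0 <= k < m) (h (nu (F k)))%:E)%E =
    (fun m => (h (\sum_(0 <= k < m) nu (F k)))%:E).
  by apply/funext => m; rewrite sumEFin (big_morph h hD h0).
apply: cvg_EFin; first exact: nearW.
exact: (cvg_comp _ _ (povm_sigma_additive (p := nu) mF tF) (hc _)).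
Qed.

Lemma comp_set0 (h : 'M[Cx R]_n -> R) :
  (forall A B, h (A + B) = h A + h B) -> continuous h -> h (nu set0) = 0.
Proof.
move=> hD hc.
have := @comp_sigma_additive h hD hc (fun=> set0) (fun=> measurable0)
  (@trivIset_set0 _ _ _).
rewrite bigcup0 // => /(_ measurable0) /fine_cvgP[_].
set r := h _ => rr.
have {}rr : (fun m => r *+ m) @ \oo --> r.
  apply: cvg_trans rr; apply: near_eq_cvg; apply: nearW => m /=.
  by rewrite sumEFin /= sumr_const_nat subn0.
have rS : (fun m => r *+ m.+1) @ \oo --> r.
  by have := rr; rewrite -cvg_shiftS.
have := cvgB rS rr.
have -> : ((fun m => r *+ m.+1) - (fun m => r *+ m)) = cst r.
  by apply/funext => m /=; rewrite fctE mulrS addrK.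
rewrite subrr => rc.
exact: (cvg_unique (@norm_hausdorff _ R) (@cvg_cst _ r _ \oo _) (rc _)).
Qed.

Lemma entry_cont (h : Cx R -> R) (i j : 'I_n) : continuous h ->
  continuous (fun A : 'M[Cx R]_n => h (A i j)).
Proof.
move=> hc A; apply: (@continuous_comp _ _ _ (fun A : 'M[Cx R]_n => A i j) h).
  exact: coord_continuous.
exact: hc.
Qed.

Lemma Re_cont : continuous (@complex.Re R : Cx R -> R).
Proof. exact: contract_cont (@ReD R) (@normRe R). Qed.

Lemma Im_cont : continuous (@complex.Im R : Cx R -> R).
Proof. exact: contract_cont (@ImD R) (@normIm R). Qed.

Lemma ReeD i j (A B : 'M[Cx R]_n) :
  complex.Re ((A + B) i j) = complex.Re (A i j) + complex.Re (B i j).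
Proof. by rewrite mxE ReD. Qed.

Lemma ImeD i j (A B : 'M[Cx R]_n) :
  complex.Im ((A + B) i j) = complex.Im (A i j) + complex.Im (B i j).
Proof. by rewrite mxE ImD. Qed.

Let tr (rho : 'M[Cx R]_n) (A : 'M[Cx R]_n) : R := complex.Re (\tr (rho *m A)).

Lemma trD rho A B : tr rho (A + B) = tr rho A + tr rho B.
Proof. by rewrite /tr mulmxDr mxtraceD ReD. Qed.

Lemma tr_cont rho : continuous (tr rho).
Proof.
move=> A.
apply: (@continuous_comp _ _ _ (fun A : 'M[Cx R]_n => \tr (rho *m A))
  (@complex.Re R : Cx R -> R)); last exact: Re_cont.
have -> : (fun A : 'M[Cx R]_n => \tr (rho *m A)) =
    (fun A : 'M[Cx R]_n => \sum_i \sum_j rho i j * A j i).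
  by apply/funext => B; apply: eq_bigr => i _; rewrite mxE.
have FA : Filter (nbhs A) by exact: nbhs_filter.
apply: (@cvg_big _ _ _ _ _ add_continuous _ _ _ _ _ FA) => i _.
apply: (@cvg_big _ _ _ _ _ add_continuous _ _ _ _ _ FA) => j _.
apply: cvgMl_tmp; exact: coord_continuous.
Qed.

Lemma psd_herm (A : 'M[Cx R]_n) : psd A -> A = A ^t*.
Proof.
move=> A0; pose B := A - A ^t*.
have B0 (v : 'cV[Cx R]_n) : (v ^t* *m B *m v) 0 0 = 0.
  have /ger0_real/CrealP rA := A0 v.
  have E : (v ^t* *m A ^t* *m v) 0 0 = (((v ^t* *m A *m v) 0 0)^*)%R.
    transitivity (((v ^t* *m A *m v) ^t*) 0 0); last by rewrite !mxE.
    by rewrite !trmx_mul !map_mxM trmxCK mulmxA.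
  by rewrite mulmxBr mulmxBl [LHS]mxE [X in _ + X]mxE E rA subrr.
pose b (u v : 'cV[Cx R]_n) := (u ^t* *m B *m v) 0 0.
have bB (i j : 'I_n) : b (delta_mx i 0) (delta_mx j 0) = B i j.
  by rewrite /b trmx_delta map_delta_mx -rowE -colE !mxE.
have bDl u v w : b (u + v) w = b u w + b v w.
  by rewrite /b [(u + v)^T]linearD map_mxD !mulmxDl mxE.
have bDr u v w : b w (u + v) = b w u + b w v by rewrite /b mulmxDr mxE.
have bZl c u w : b (c *: u) w = (c^*)%R * b u w.
  by rewrite /b [(c *: u)^T]linearZ map_mxZ -!scalemxAl mxE.
have bZr c u w : b w (c *: u) = c * b w u.
  by rewrite /b -scalemxAr mxE.
have bP (c : Cx R) u v : c * b u v + (c^*)%R * b v u = 0.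
  have := B0 (u + c *: v); rewrite -/(b _ _) bDl !bDr !bZl !bZr.
  by rewrite [b u u]B0 [b v v]B0 !mulr0 addr0 add0r.
suff BE : B = 0 by apply/eqP; rewrite -subr_eq0 -/B BE.
apply/matrixP => i j; rewrite [RHS]mxE -bB.
set x := b _ _.
have := bP 1 (delta_mx i 0) (delta_mx j 0).
rewrite conjC1 !mul1r -/x => /eqP; rewrite addr_eq0 => /eqP xE.
have := bP ('i)%R (delta_mx i 0) (delta_mx j 0).
rewrite conjCi -/x mulNr -mulrN -xE -mulr2n => /eqP.
by rewrite mulrn_eq0 /= mulf_eq0 (negPf (neq0Ci _)) => /eqP.
Qed.

Lemma psd_tr_ge0 (S : state R n) (A : 'M[Cx R]_n) :
  psd A -> 0 <= complex.Re (\tr (S *m A)).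
Proof.
move=> A0; have S0 := state_psd S.
have /orthomx_spectralP : (S : 'M[Cx R]_n) \is normalmx.
  by rewrite qualifE /= -(psd_herm S0).
set P := spectralmx _; set d := spectral_diag _ => SE.
have uP : P \is unitarymx by exact: spectral_unitarymx.
have PV : invmx P = P ^t* by exact: invmx_unitary.
have PU : P \in unitmx by exact: unitarymx_unit.
suff : 0 <= \tr (S *m A) by rewrite lecE /= => /andP[].
have quad (M : 'M[Cx R]_n) i : psd M -> 0 <= (P *m M *m invmx P) i i.
  move=> /(_ ((row i P) ^t*)); rewrite trmxCK PV; congr (_ <= _).
  rewrite -row_mul !mxE; apply: eq_bigr => k _; by rewrite !mxE.
have d0 i : 0 <= d 0 i.
  have := quad _ i S0; rewrite {1}SE -!mulmxA mulmxV // mulmx1 mulKVmx //.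
  by rewrite mxE eqxx.
rewrite SE -!mulmxA mxtrace_mulC -mulmxA mul_diag_mx.
by apply: sumr_ge0 => i _; rewrite mxE mulr_ge0 // quad.
Qed.

Lemma nuRe0 i j : nuRe nu i j set0 = 0%E.
Proof.
rewrite /nuRe (@comp_set0 (fun A => complex.Re (A i j)) (ReeD i j))//.
exact: entry_cont Re_cont.
Qed.

Lemma nuRe_fin i j E : measurable E -> nuRe nu i j E \is a fin_num.
Proof. by []. Qed.

Lemma nuRe_sigma_additive i j : semi_sigma_additive (nuRe nu i j).
Proof.
apply: (@comp_sigma_additive (fun A => complex.Re (A i j)) (ReeD i j)).
exact: entry_cont Re_cont.
Qed.

HB.instance Definition _ i j := isCharge.Build _ (borel X) R (nuRe nu i j)
  (nuRe0 i j) (@nuRe_fin i j) (@nuRe_sigma_additive i j).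

Lemma nuIm0 i j : nuIm nu i j set0 = 0%E.
Proof.
rewrite /nuIm (@comp_set0 (fun A => complex.Im (A i j)) (ImeD i j))//.
exact: entry_cont Im_cont.
Qed.

Lemma nuIm_fin i j E : measurable E -> nuIm nu i j E \is a fin_num.
Proof. by []. Qed.

Lemma nuIm_sigma_additive i j : semi_sigma_additive (nuIm nu i j).
Proof.
apply: (@comp_sigma_additive (fun A => complex.Im (A i j)) (ImeD i j)).
exact: entry_cont Im_cont.
Qed.

HB.instance Definition _ i j := isCharge.Build _ (borel X) R (nuIm nu i j)
  (nuIm0 i j) (@nuIm_fin i j) (@nuIm_sigma_additive i j).

Context (rho : state R n).

Lemma nurhoE E : measurable E ->
  nurho nu rho E = (complex.Re (\tr (rho *m nu E)))%:E.
Proof. by rewrite /nurho => /asboolT ->. Qed.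

Lemma nurho0 : nurho nu rho set0 = 0%E.
Proof.
rewrite nurhoE//; congr EFin.
exact: (@comp_set0 (tr rho) (trD rho) (@tr_cont rho)).
Qed.

Lemma nurho_ge0 E : (0 <= nurho nu rho E)%E.
Proof.
rewrite /nurho; case: asboolP => // mE; rewrite lee_fin.
exact/psd_tr_ge0/povm_psd.
Qed.

Lemma nurho_sigma_additive : semi_sigma_additive (nurho nu rho).
Proof.
move=> F mF tF mUF; rewrite nurhoE//.
under eq_fun do under eq_bigr do rewrite nurhoE//.
exact: (@comp_sigma_additive (tr rho) (trD rho) (@tr_cont rho)).
Qed.

HB.instance Definition _ := isMeasure.Build _ (borel X) R (nurho nu rho)
  nurho0 nurho_ge0 nurho_sigma_additive.

Lemma nurho_fin : fin_num_fun (nurho nu rho).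
Proof. by move=> E mE; rewrite nurhoE. Qed.

HB.instance Definition _ := Measure_isFinite.Build _ (borel X) R
  (nurho nu rho) nurho_fin.

End PovmFacts.

Section QuantumRandomVariables.
Context (R : realType) (n : nat) (X : ptopologicalType).
Context (nu : povm R n X) (rho : state R n).
Implicit Types f g : borel X -> 'M[Cx R]_n.

(* The matrix of Radon-Nikodym derivatives of the complex measures nu_ij; the
   library's derivative of a signed measure is an extended real function, which
   is finite when the measure is absolutely continuous. *)
Definition RNmx (x : borel X) : 'M[Cx R]_n :=
  \matrix_(i, j) (fine ('d (nuRe nu i j) '/d (nurho nu rho) x)
                  +i* fine ('d (nuIm nu i j) '/d (nurho nu rho) x)).

Definition qrv f : Prop := forall s : state R n,
  measurable_fun [set: borel X] (fun x => \tr (s *m f x) : borel (Cx R)).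

Definition ae_psd f : Prop := {ae nurho nu rho, forall x, psd (f x)}.

Definition LH f : Prop :=
  exists m (c : 'I_m -> Cx R) (h : 'I_m -> borel X -> 'M[Cx R]_n),
    (forall k, qrv (h k) /\ ae_psd (h k)) /\
    forall x, f x = \sum_k c k *: h k x.

Definition qeval (s : state R n) f (x : borel X) : Cx R :=
  \tr (s *m mxpow (RNmx x) 2^-1 *m f x *m mxpow (RNmx x) 2^-1).

Definition Posf f (f1 f2 f3 f4 : borel X -> 'M[Cx R]_n) : Prop :=
  [/\ LH f1 /\ ae_psd f1, LH f2 /\ ae_psd f2,
      LH f3 /\ ae_psd f3, LH f4 /\ ae_psd f4 &
      forall x, f x = f1 x - f2 x + (0 +i* 1 : Cx R) *: (f3 x - f4 x)].

(* The integrand is real, being the qeval of an a.e. positive function. *)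
Definition norm1 f : \bar R :=
  ereal_inf [set r | exists f1 f2 f3 f4, Posf f f1 f2 f3 f4 /\
    r = ereal_sup [set (\int[nurho nu rho]_x
          (complex.Re (qeval s (fun y => f1 y + f2 y + f3 y + f4 y) x))%:E)%E
          | s in [set: state R n]]].

Definition L1 f : Prop := LH f /\ (norm1 f < +oo)%E.

End QuantumRandomVariables.

(* Main.v *)
Require Import Defs.
From mathcomp Require Import all_boot all_order all_algebra.
From mathcomp Require Import all_classical all_reals all_analysis.
From mathcomp Require Import measurable_realfun complex ring lra.

Set Implicit Arguments.
Unset Strict Implicit.
Unset Printing Implicit Defensive.

Import Order.TTheory GRing.Theory Num.Theory.
Import numFieldNormedType.Exports.

Local Open Scope classical_set_scope.
Local Open Scope ring_scope.

(** On positive functions the norm is explicit: it is the supremum over the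
    states s of the integral of the density f_s ([norm1_psd]). A positive f is
    one of its own decompositions, and in any decomposition
    f = f1 - f2 + i (f3 - f4) the hermitian part gives
    f = f1 - f2 <= f1 + f2 + f3 + f4. For a fixed state, f_s(x) is a positive
    linear functional of f(x), so operator inequalities between values pass to
    the integrals.

    Almost everywhere f(x) and g(x) are commuting positive matrices. They are
    diagonal in a common orthonormal basis ([psd_codiagonalization]), in which
    f(x)^p and g(x)^q are diagonal as well. Hence f(x) g(x) is positive, and
    Young's inequality for the eigenvalues is the operator inequality
      f g <= a b (f^p / (p a^p) + g^q / (q b^q)),   a, b > 0
    ([psd_young]). Integrated against each state, it bounds the norm of f g by
    a b as soon as the norms of f^p and g^q are at most a^p and b^q. Letting a
    and b decrease to the p-th and q-th roots of these norms gives the claim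
    ([hoelder_of_young]).

    Integrals add up and compare only for measurable densities, and f_s
    contains the square root of the matrix of Radon-Nikodym derivatives.
    Square roots of positive matrices are limits of matrix polynomials
    ([sqrtmx_iter_cvg]), which makes them measurable, and the square root of
    A^* A tells whether A is positive ([mxmeas_sqrt]). *)

(** * Real and imaginary parts *)

Section ComplexNumbers.
Local Open Scope complex_scope.
Context {R : realType}.
Implicit Types (a b : R) (z w : Cx R).

Lemma real_cxD a b : ((a + b)%:C : Cx R) = (a%:C : Cx R) + (b%:C : Cx R).
Proof. exact: (rmorphD (real_complex R)). Qed.

Lemma real_cxM a b : ((a * b)%:C : Cx R) = (a%:C : Cx R) * (b%:C : Cx R).
Proof. exact: (rmorphM (real_complex R)). Qed.

Lemma cx_ReM z w : complex.Re (z * w : Cx R) =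
  complex.Re z * complex.Re w - complex.Im z * complex.Im w.
Proof. by case: z w => [a b] [c d]. Qed.

Lemma cx_ImM z w : complex.Im (z * w : Cx R) =
  complex.Re z * complex.Im w + complex.Im z * complex.Re w.
Proof. by case: z w => [a b] [c d]. Qed.

Lemma cx_Re_conj z : complex.Re (z^*)%R = complex.Re z.
Proof. by case: z. Qed.

Lemma cx_Im_conj z : complex.Im (z^*)%R = - complex.Im z.
Proof. by case: z. Qed.

Lemma cx_ge0P z : 0 <= z <-> 0 <= complex.Re z /\ complex.Im z = 0.
Proof.
rewrite lecE /=; split=> [/andP[/eqP ? ?]|[? ->]]//=; last by rewrite eqxx.
Qed.

Lemma cx_ge0_real z : 0 <= z -> z = (complex.Re z)%:C.
Proof. by move=> /cx_ge0P[_]; case: z => a b /= ->. Qed.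

Lemma Re_sum (I : Type) (s : seq I) (z : I -> Cx R) :
  complex.Re (\sum_(i <- s) z i) = \sum_(i <- s) complex.Re (z i).
Proof. by apply: (big_morph _ (@ReD R)). Qed.

Lemma Im_sum (I : Type) (s : seq I) (z : I -> Cx R) :
  complex.Im (\sum_(i <- s) z i) = \sum_(i <- s) complex.Im (z i).
Proof. by apply: (big_morph _ (@ImD R)). Qed.

Lemma norm_cx_le (z : Cx R) (e : R) :
  `|complex.Re z| < e -> `|complex.Im z| < e -> `|z| < (e + e)%:C.
Proof.
case: z => a b /= ae be.
have e0 : 0 <= e by exact: le_trans (ltW ae).
rewrite ltcR -[e + e]ger0_norm ?addr_ge0// -sqrtr_sqr ltr_sqrt; last first.
  by rewrite exprn_gt0// -[0]addr0 ltrD// (le_lt_trans _ ae).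
rewrite -[a ^+ 2]real_normK ?num_real// -[b ^+ 2]real_normK ?num_real//.
have a2 : `|a| ^+ 2 < e ^+ 2 by rewrite ltr_pXn2r// nnegrE.
have b2 : `|b| ^+ 2 < e ^+ 2 by rewrite ltr_pXn2r// nnegrE.
have := sqr_ge0 e; rewrite (_ : (e + e) ^+ 2 = 4 * e ^+ 2); last by ring.
lra.
Qed.

End ComplexNumbers.

(** * Matrices diagonal in an orthonormal basis *)

Section UnitaryDiagonalization.
Local Open Scope sesquilinear_scope.
Context {C : numClosedFieldType} {n : nat}.
Implicit Types (P Q A B : 'M[C]_n) (c d : 'rV[C]_n).

Definition unitary_diag P d : 'M[C]_n := P ^t* *m diag_mx d *m P.

Lemma unitarymx_adjK P : P \is unitarymx -> P ^t* *m P = 1%:M.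
Proof. by move=> uP; rewrite -(invmx_unitary uP) mulVmx// unitarymx_unit. Qed.

Lemma unitary_diagE P d i j :
  unitary_diag P d i j = \sum_l (P l i)^* * P l j * d 0 l.
Proof.
rewrite !mxE; apply: eq_bigr => l _; rewrite mul_mx_diag !mxE.
by rewrite mulrAC.
Qed.

Lemma unitary_diagD P c d :
  unitary_diag P c + unitary_diag P d = unitary_diag P (c + d).
Proof. by rewrite /unitary_diag -mulmxDl -mulmxDr [in RHS]linearD. Qed.

Lemma unitary_diagZ P d (a : C) :
  a *: unitary_diag P d = unitary_diag P (a *: d).
Proof. by rewrite /unitary_diag [in RHS]linearZ /= -scalemxAr -scalemxAl. Qed.

Lemma unitary_diagM P c d : P \is unitarymx ->
  unitary_diag P c *m unitary_diag P d =
  unitary_diag P (\row_l (c 0 l * d 0 l)).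
Proof.
move=> uP; rewrite /unitary_diag !mulmxA mulmxtVK//.
by rewrite -[_ *m diag_mx _ *m diag_mx _]mulmxA mulmx_diag.
Qed.

Lemma unitary_diag_form_ge0 P d (v : 'cV[C]_n) : (forall l, 0 <= d 0 l) ->
  0 <= (v ^t* *m unitary_diag P d *m v) 0 0.
Proof.
move=> d0; have -> : v ^t* *m unitary_diag P d *m v =
    (P *m v) ^t* *m diag_mx d *m (P *m v).
  by rewrite /unitary_diag trmx_mul map_mxM !mulmxA.
rewrite mxE; apply: sumr_ge0 => l _; rewrite mul_mx_diag !mxE.
by rewrite mulrAC mulr_ge0// mulrC mul_conjC_ge0.
Qed.

Lemma unitary_diag_conj P A d : P \is unitarymx ->
  P *m A *m P ^t* = diag_mx d -> A = unitary_diag P d.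
Proof.
move=> uP dE; rewrite /unitary_diag -dE -!mulmxA (unitarymx_adjK uP) mulmx1.
by rewrite mulmxA (unitarymx_adjK uP) mul1mx.
Qed.

(** An intertwiner W of two diagonal matrices satisfies d i * W i j = W i j * e j,
    so that W i j vanishes unless d i = e j; it then intertwines any function
    of them. Applied to W = P *m Q ^t*, this makes functional calculus
    independent of the eigenbasis. *)
Lemma unitary_diag_map P Q c d (phi : C -> C) :
    P \is unitarymx -> Q \is unitarymx ->
    unitary_diag P c = unitary_diag Q d ->
  unitary_diag P (map_mx phi c) = unitary_diag Q (map_mx phi d).
Proof.
move=> uP uQ; pose W := P *m Q ^t*.
have key c' d' : unitary_diag P c' = unitary_diag Q d' <->
    diag_mx c' *m W = W *m diag_mx d'.
  split=> [/(congr1 (fun M => P *m M *m Q ^t*))|e].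
    by rewrite /unitary_diag !mulmxA (unitarymxP uP) mul1mx mulmxtVK// /W !mulmxA.
  transitivity (P ^t* *m (diag_mx c' *m W) *m Q).
    by rewrite /unitary_diag /W -!mulmxA (unitarymx_adjK uQ) mulmx1.
  by rewrite e /unitary_diag /W !mulmxA (unitarymx_adjK uP) mul1mx.
move=> /key /matrixP e; apply/key; apply/matrixP => i j.
have := e i j; rewrite !mul_diag_mx !mul_mx_diag !mxE.
set w := \sum_(_ < _) _.
have [->|w0] := eqVneq w 0; first by rewrite !mulr0 !mul0r.
by rewrite mulrC => /(mulfI w0) ->; rewrite mulrC.
Qed.

Lemma diag_conj_form P A l :
  (P *m A *m P ^t*) l l = (((row l P) ^t*) ^t* *m A *m (row l P) ^t*) 0 0.
Proof.
by rewrite trmxCK -row_mul !mxE; apply: eq_bigr => k _; rewrite !mxE.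
Qed.

(** Conjugate transposition exchanges the two triangles of the matrix. *)
Lemma hermitian_trig_diag P A : P \is unitarymx -> A ^t* = A ->
  is_trig_mx (P *m A *m P ^t*) ->
  A = unitary_diag P (\row_l (P *m A *m P ^t*) l l).
Proof.
move=> uP hA /is_trig_mxP tA; apply: unitary_diag_conj => //.
set M := P *m A *m P ^t*.
have h : M ^t* = M by rewrite !trmx_mul !map_mxM trmxCK hA mulmxA.
apply/matrixP => i j; rewrite [RHS]mxE [X in _ = X *+ _]mxE.
have [->|ij] := eqVneq i j; first by rewrite mulr1n.
rewrite mulr0n; have [lij|lij|/val_inj eij] := ltngtP i j; last first.
- by rewrite eij eqxx in ij.
- by rewrite -h mxE mxE [M _ _]tA// conjC0.
- exact: tA.
Qed.

Lemma hermitian_spectral A : A ^t* = A ->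
  A = unitary_diag (spectralmx A) (spectral_diag A).
Proof.
move=> hA; have /orthomx_spectralP AE : A \is normalmx by rewrite qualifE /= hA.
by rewrite {1}AE invmx_unitary ?spectral_unitarymx.
Qed.

Lemma unitary_diag_form P d l : P \is unitarymx ->
  (((row l P) ^t*) ^t* *m unitary_diag P d *m (row l P) ^t*) 0 0 = d 0 l.
Proof.
move=> uP; rewrite -diag_conj_form /unitary_diag !mulmxA.
by rewrite (unitarymxP uP) mul1mx mulmxtVK// mxE eqxx mulr1n.
Qed.

Lemma mxtrace_unitary_diag P d : P \is unitarymx ->
  \tr (unitary_diag P d) = \sum_l d 0 l.
Proof.
move=> uP; rewrite /unitary_diag mxtrace_mulC mulmxA (unitarymxP uP) mul1mx.
exact: mxtrace_diag.
Qed.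

(** With b the sesquilinear form of M, s c is c * b u w + c^* * b w u when c has
    modulus 1. Differences are written with factors -1 and - 'i, so that only sums
    and multiples of values of q occur. *)
Lemma polarization (M : 'M[C]_n) (i j : 'I_n) :
  let q (v : 'cV[C]_n) : C := (v ^t* *m M *m v) 0 0 in
  let u : 'cV[C]_n := delta_mx i 0 in
  let w : 'cV[C]_n := delta_mx j 0 in
  let s (c : C) : C := q (u + c *: w) + -1 * (q u + q w) in
  M i j = 2^-1 * (s 1 + - 'i * s 'i)%R.
Proof.
move=> q u w s; pose b (v1 v2 : 'cV[C]_n) : C := (v1 ^t* *m M *m v2) 0 0.
have bE : b u w = M i j.
  by rewrite /b trmx_delta map_delta_mx -rowE -colE !mxE.
have bDl v1 v2 v : b (v1 + v2) v = b v1 v + b v2 v.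
  by rewrite /b [(v1 + v2)^T]linearD map_mxD !mulmxDl mxE.
have bDr v1 v2 v : b v (v1 + v2) = b v v1 + b v v2 by rewrite /b mulmxDr mxE.
have bZl (a : C) v1 v : b (a *: v1) v = a^* * b v1 v.
  by rewrite /b [(a *: v1)^T]linearZ map_mxZ -!scalemxAl mxE.
have bZr (a : C) v1 v : b v (a *: v1) = a * b v v1 by rewrite /b -scalemxAr mxE.
have sE (a : C) : a^* * a = 1 -> s a = a * b u w + a^* * b w u.
  move=> a1; rewrite /s -[q u]/(b u u) -[q w]/(b w w) -[q _]/(b _ _).
  rewrite bDl !bDr !bZl !bZr mulrA a1.
  have aux (x y z t : C) : x + y + (z + 1 * t) + -1 * (x + t) = y + z by ring.
  exact: aux.
rewrite !sE ?conjC1 ?mulr1// ?conjCi; last first.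
  by rewrite mulNr -expr2 sqrCi opprK.
rewrite -bE; set b1 := b u w; set b2 := b w u.
have i2 : 'i * 'i = -1 :> C by rewrite -expr2 sqrCi.
transitivity (2^-1 * (2 * b1 + ('i * 'i + 1) * (b2 - b1))); last by congr (_ * _); ring.
by rewrite i2 addNr mul0r addr0 mulrA mulVf ?mul1r// pnatr_eq0.
Qed.

Lemma mxtrace_rank_one (v : 'cV[C]_n) (M : 'M[C]_n) :
  \tr (v *m v ^t* *m M) = (v ^t* *m M *m v) 0 0.
Proof. by rewrite -mulmxA mxtrace_mulC /mxtrace big_ord1. Qed.

End UnitaryDiagonalization.

(** * Positive matrices and their powers *)

Section PositiveMatrices.
Local Open Scope sesquilinear_scope.
Local Open Scope complex_scope.
Context {R : realType} {n : nat}.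
Implicit Types (P A B : 'M[Cx R]_n) (x y : 'I_n -> R).

(** Real eigenvalues, to which the real powers in [mxpow] apply. *)
Definition real_row x : 'rV[Cx R]_n := \row_l (x l)%:C.

Definition udiag P x : 'M[Cx R]_n := unitary_diag P (real_row x).

Lemma udiagE P x i j :
  udiag P x i j = \sum_l ((P l i)^* * P l j * ((x l)%:C : Cx R))%R.
Proof. by rewrite [LHS]unitary_diagE; apply: eq_bigr => l _; rewrite mxE. Qed.

Lemma udiagD P x y : udiag P x + udiag P y = udiag P (fun l => x l + y l).
Proof.
rewrite [LHS]unitary_diagD; congr unitary_diag.
by apply/rowP => l; rewrite !mxE -real_cxD.
Qed.

Lemma udiagZ P x (c : R) :
  (c%:C : Cx R) *: udiag P x = udiag P (fun l => c * x l).
Proof.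
rewrite [LHS]unitary_diagZ; congr unitary_diag.
by apply/rowP => l; rewrite !mxE -real_cxM.
Qed.

Lemma udiagN P x : - udiag P x = udiag P (fun l => - x l).
Proof.
rewrite -[LHS]scaleN1r -[-1 in LHS]/(-1 : Cx R).
have -> : (-1 : Cx R) = (- 1)%:C by apply/eqP; rewrite eq_complex /= oppr0 !eqxx.
by rewrite udiagZ; congr udiag; apply/funext => l; rewrite mulN1r.
Qed.

Lemma udiagM P x y : P \is unitarymx ->
  udiag P x *m udiag P y = udiag P (fun l => x l * y l).
Proof.
move=> uP; rewrite [LHS](unitary_diagM _ _ uP); congr unitary_diag.
by apply/rowP => l; rewrite !mxE -real_cxM.
Qed.

Lemma psd_udiag P x : (forall l, 0 <= x l) -> psd (udiag P x).
Proof.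
by move=> x0 v; apply: unitary_diag_form_ge0 => l; rewrite mxE (@ler0c R).
Qed.

(** The eigenvalues are values of the quadratic form. *)
Lemma psd_unitary_diag P (d : 'rV[Cx R]_n) : P \is unitarymx ->
    psd (unitary_diag P d) ->
  exists x, (forall l, 0 <= x l) /\ unitary_diag P d = udiag P x.
Proof.
move=> uP A0.
have d0 l : 0 <= d 0 l by rewrite -(unitary_diag_form _ _ uP); exact: A0.
exists (fun l => complex.Re (d 0 l) : R); split.
  by move=> l; have /cx_ge0P[] := d0 l.
by congr unitary_diag; apply/rowP => l; rewrite mxE -cx_ge0_real.
Qed.

Lemma psd_udiagP A : psd A ->
  exists P x, [/\ P \is unitarymx, forall l, 0 <= x l & A = udiag P x].
Proof.
move=> A0; have AE := @hermitian_spectral (Cx R) n A (esym (psd_herm A0)).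
have uP := spectral_unitarymx A.
have A1 : psd (unitary_diag (spectralmx A) (spectral_diag A)).
  by rewrite -[X in psd X]AE.
have [x [x0 xE]] := psd_unitary_diag uP A1.
by exists (spectralmx A), x; split; [exact: uP | exact: x0 | exact (etrans AE xE)].
Qed.

(** Commuting matrices are triangular in a common orthonormal basis, and there
    hermitian matrices are diagonal. *)
Lemma psd_codiagonalization A B : psd A -> psd B -> A *m B = B *m A ->
  exists P x y, [/\ P \is unitarymx, forall l, 0 <= x l, forall l, 0 <= y l,
    A = udiag P x & B = udiag P y].
Proof.
move=> A0 B0 /cotrigonalization2[P uP /andP[tA tB]].
have diagP M : psd M -> similar_trig P M ->
    exists x, (forall l, 0 <= x l) /\ M = udiag P x.
  move=> M0; rewrite /similar_to conjymx// => tM.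
  have ME := @hermitian_trig_diag (Cx R) n P M uP (esym (psd_herm M0)) tM.
  have M1 : psd (unitary_diag P (\row_l (P *m M *m P ^t*) l l)).
    by rewrite -[X in psd X]ME.
  have [x [x0 xE]] := psd_unitary_diag uP M1.
  by exists x; split; [exact: x0 | exact (etrans ME xE)].
have [x [x0 xE]] := diagP A A0 tA; have [y [y0 yE]] := diagP B B0 tB.
by exists P, x, y; split; [exact: uP | exact: x0 | exact: y0 | exact: xE | exact: yE].
Qed.

(** The power is defined through one chosen eigenbasis; by [unitary_diag_map]
    the choice does not matter. *)
Lemma mxpow_udiag P x (r : R) : P \is unitarymx -> (forall l, 0 <= x l) ->
  mxpow (udiag P x) r = udiag P (fun l => x l `^ r).
Proof.
move=> uP x0; have A0 := psd_udiag P x0; rewrite /mxpow asboolT//.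
set A := udiag P x.
have AE := @hermitian_spectral (Cx R) n A (esym (psd_herm A0)).
rewrite (invmx_unitary (spectral_unitarymx A)) -[LHS]/(unitary_diag _ _).
rewrite -(unitary_diag_map _ uP (spectral_unitarymx A) AE).
by congr unitary_diag; apply/rowP => l; rewrite !mxE.
Qed.

Lemma psd0 : psd (0 : 'M[Cx R]_n).
Proof. by move=> v; rewrite mulmx0 mul0mx mxE. Qed.

Lemma psdD A B : psd A -> psd B -> psd (A + B).
Proof. by move=> A0 B0 v; rewrite mulmxDr mulmxDl mxE addr_ge0. Qed.

Lemma psd_congr m A (H : 'M[Cx R]_(n, m)) : psd A -> psd (H ^t* *m A *m H).
Proof.
by move=> A0 v; have := A0 (H *m v); rewrite trmx_mul map_mxM !mulmxA.
Qed.

Lemma mxpow_psd A (r : R) : psd (mxpow A r).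
Proof.
have [A0|nA] := pselect (psd A); last first.
  by rewrite /mxpow asboolF//; exact: psd0.
have [P [x [uP x0 ->]]] := psd_udiagP A0.
rewrite (mxpow_udiag r uP x0).
by apply: psd_udiag => l; exact: powR_ge0.
Qed.

Lemma mxtrace_udiag P (a : 'I_n -> R) : P \is unitarymx ->
  complex.Re (\tr (udiag P a)) = \sum_l a l.
Proof.
move=> uP; rewrite (mxtrace_unitary_diag _ uP) Re_sum.
by apply: eq_bigr => l _; rewrite mxE.
Qed.

Lemma psd_gram m (A : 'M[Cx R]_(m, n)) : psd (A ^t* *m A).
Proof.
move=> v; have -> : v ^t* *m (A ^t* *m A) *m v = (A *m v) ^t* *m (A *m v).
  by rewrite trmx_mul map_mxM !mulmxA.
rewrite mxE; apply: sumr_ge0 => l _; rewrite !mxE mulrC.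
exact: mul_conjC_ge0.
Qed.

Lemma psdZ (c : R) (A : 'M[Cx R]_n) : 0 <= c -> psd A ->
  psd ((c%:C : Cx R) *: A).
Proof.
move=> c0 A0 v; rewrite -scalemxAr -scalemxAl mxE.
by apply: mulr_ge0; [rewrite (@ler0c R) | exact: A0].
Qed.

Lemma psd_trace_ge0 (A : 'M[Cx R]_n) : psd A -> 0 <= \tr A.
Proof.
move=> A0; have [P [a [uP a0 ->]]] := psd_udiagP A0.
rewrite (mxtrace_unitary_diag _ uP); apply: sumr_ge0 => l _.
by rewrite mxE (@ler0c R).
Qed.

Lemma sqrt_psd_sqr (A : 'M[Cx R]_n) : psd A -> mxpow (A ^t* *m A) 2^-1 = A.
Proof.
move=> A0; have [P [a [uP a0 AE]]] := psd_udiagP A0.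
rewrite -[A ^t*](psd_herm A0) AE (udiagM _ _ uP) (mxpow_udiag _ uP).
  by congr (udiag P _); apply/funext => l; rewrite powR12_sqrt ?mulr_ge0// -expr2 sqrtr_sqr ger0_norm.
by move=> l; rewrite mulr_ge0.
Qed.

(** Since A is hermitian, A3 - A4 vanishes and A is A1 - A2; what remains is
    2 A2 + A3 + A4. *)
Lemma psd_four_parts A A1 A2 A3 A4 :
    psd A1 -> psd A2 -> psd A3 -> psd A4 ->
    A = A1 - A2 + (0 +i* 1 : Cx R) *: (A3 - A4) ->
  psd A -> psd (A1 + A2 + A3 + A4 - A).
Proof.
move=> p1 p2 p3 p4 AE p0 v.
pose q (B : 'M[Cx R]_n) : Cx R := (v ^t* *m B *m v) 0 0.
have qD (B C : 'M[Cx R]_n) : q (B + C) = q B + q C.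
  by rewrite /q mulmxDr mulmxDl mxE.
have qN (B : 'M[Cx R]_n) : q (- B) = - q B.
  by rewrite /q mulmxN mulNmx mxE.
have qZ (c : Cx R) (B : 'M[Cx R]_n) : q (c *: B) = c * q B.
  by rewrite /q -scalemxAr -scalemxAl mxE.
have h1 : 0 <= q A1 := p1 v; have h2 : 0 <= q A2 := p2 v.
have h3 : 0 <= q A3 := p3 v; have h4 : 0 <= q A4 := p4 v.
have h0 : 0 <= q A := p0 v.
have qA : q A = q A1 - q A2 + (0 +i* 1 : Cx R) * (q A3 - q A4).
  by rewrite AE (qD (A1 - A2)) (qD A1) (qN A2) qZ (qD A3) (qN A4).
suff : 0 <= q (A1 + A2 + A3 + A4 - A) by [].
rewrite (qD _ (- A)) (qN A) (qD _ A4) (qD _ A3) (qD A1 A2).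
rewrite {}qA in h0 *.
case: (q A1) (q A2) (q A3) (q A4) h1 h2 h3 h4 h0
  => [a1 b1] [a2 b2] [a3 b3] [a4 b4].
move=> /cx_ge0P[/= h1 e1] /cx_ge0P[/= h2 e2] /cx_ge0P[/= h3 e3] /cx_ge0P[/= h4 e4].
move=> /cx_ge0P[/= h0 e0]; apply/cx_ge0P => /=; split; lra.
Qed.

Lemma psd_mulmx_comm A B : psd A -> psd B -> A *m B = B *m A -> psd (A *m B).
Proof.
move=> A0 B0 AB; have [P [x [y [uP x0 y0 -> ->]]]] := psd_codiagonalization A0 B0 AB.
by rewrite (udiagM _ _ uP); apply: psd_udiag => l; rewrite mulr_ge0.
Qed.

(** Young's inequality for x / a and y / b, multiplied by a * b. *)
Lemma powR_young (p q a b x y : R) : 1 < p -> 1 < q -> p^-1 + q^-1 = 1 ->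
    0 < a -> 0 < b -> 0 <= x -> 0 <= y ->
  x * y <= a * b * (p * a `^ p)^-1 * x `^ p + a * b * (q * b `^ q)^-1 * y `^ q.
Proof.
move=> p1 q1 pq a0 b0 x0 y0.
have p0 : 0 < p by exact: lt_trans ltr01 p1.
have q0 : 0 < q by exact: lt_trans ltr01 q1.
have xa : 0 <= x / a by exact: divr_ge0 x0 (ltW a0).
have yb : 0 <= y / b by exact: divr_ge0 y0 (ltW b0).
have := conjugate_powR xa yb p0 q0 pq.
rewrite -(ler_pM2l (mulr_gt0 a0 b0)).
have -> : a * b * (x / a * (y / b)) = x * y by field; rewrite !gt_eqF.
have ap : 0 < a `^ p by exact: powR_gt0.
have bq : 0 < b `^ q by exact: powR_gt0.
have div (c r z : R) : 0 < c -> 0 <= z -> (z / c) `^ r = z `^ r / c `^ r.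
  move=> c0 z0; rewrite powRM ?invr_ge0 ?(ltW c0)//; congr (_ * _).
  by rewrite -powR_inv1 ?(ltW c0)// -powRrM mulN1r powRN.
rewrite !div//; congr (_ <= _).
by field; rewrite !gt_eqF.
Qed.

(** In a common eigenbasis this is [powR_young] for each pair of eigenvalues. *)
Lemma psd_young (p q a b : R) A B : 1 < p -> 1 < q -> p^-1 + q^-1 = 1 ->
    0 < a -> 0 < b -> psd A -> psd B -> A *m B = B *m A ->
  psd (((a * b * (p * a `^ p)^-1)%:C : Cx R) *: mxpow A p +
       ((a * b * (q * b `^ q)^-1)%:C : Cx R) *: mxpow B q - A *m B).
Proof.
move=> p1 q1 pq a0 b0 A0 B0 AB.
have [P [x [y [uP x0 y0 -> ->]]]] := psd_codiagonalization A0 B0 AB.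
set c1 := a * b * (p * _)^-1; set c2 := a * b * (q * _)^-1.
have key M1 M2 M3 : M1 = udiag P (fun l => x l `^ p) ->
    M2 = udiag P (fun l => y l `^ q) -> M3 = udiag P (fun l => x l * y l) ->
    psd ((c1%:C : Cx R) *: M1 + (c2%:C : Cx R) *: M2 - M3).
  move=> -> -> ->; rewrite (udiagZ P _ c1) (udiagZ P _ c2).
  rewrite (udiagN P (fun l => x l * y l)).
  rewrite (udiagD P (fun l => c1 * x l `^ p) (fun l => c2 * y l `^ q)).
  rewrite (udiagD P (fun l => c1 * x l `^ p + c2 * y l `^ q)).
  by apply: psd_udiag => l; rewrite subr_ge0 powR_young.
exact: key (mxpow_udiag p uP x0) (mxpow_udiag q uP y0) (udiagM x y uP).
Qed.

End PositiveMatrices.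

(** * Measurability of complex functions *)

Section ComplexMeasurability.
Local Open Scope sesquilinear_scope.
Local Open Scope complex_scope.
Context {R : realType} {d : measure_display} {T : measurableType d}.
Implicit Types (u v : T -> Cx R).

(** Sums and products reduce to the real case in this form; for the Borel sets
    of the plane see [borel_cmeas]. *)
Definition cmeas u : Prop :=
  measurable_fun [set: T] (fun x => complex.Re (u x)) /\
  measurable_fun [set: T] (fun x => complex.Im (u x)).

Lemma cmeas_cst (c : Cx R) : cmeas (fun=> c).
Proof. by split; exact: measurable_cst. Qed.

Lemma cmeasD u v : cmeas u -> cmeas v -> cmeas (fun x => u x + v x).
Proof.
move=> [ru iu] [rv iv]; split.
  by under eq_fun do rewrite ReD; exact: measurable_funD.
by under eq_fun do rewrite ImD; exact: measurable_funD.
Qed.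

Lemma cmeasM u v : cmeas u -> cmeas v -> cmeas (fun x => u x * v x).
Proof.
move=> [ru iu] [rv iv]; split.
  by under eq_fun do rewrite cx_ReM; apply: measurable_funB; exact: measurable_funM.
by under eq_fun do rewrite cx_ImM; apply: measurable_funD; exact: measurable_funM.
Qed.

Lemma cmeas_sum (I : Type) (s : seq I) (u : I -> T -> Cx R) :
  (forall i, cmeas (u i)) -> cmeas (fun x => \sum_(i <- s) u i x).
Proof.
move=> mu; elim: s => [|i s IH].
  by under eq_fun do rewrite big_nil; exact: cmeas_cst.
by under eq_fun do rewrite big_cons; exact: cmeasD.
Qed.

Lemma cmeas_conj u : cmeas u -> cmeas (fun x => ((u x)^*)%R).
Proof.
move=> [ru iu]; split; first by under eq_fun do rewrite cx_Re_conj.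
by under eq_fun do rewrite cx_Im_conj; exact: measurable_funN.
Qed.

Lemma cmeas_real (h : T -> R) : measurable_fun [set: T] h ->
  cmeas (fun x => (h x)%:C).
Proof. by move=> mh; split=> //=; exact: measurable_cst. Qed.

(** The rational squares inside an open set of the plane cover it, and there
    are countably many of them; so real and imaginary parts detect
    measurability for the Borel sets of the plane. *)
Lemma borel_cmeas u :
  measurable_fun [set: T] (u : T -> borel (Cx R)) <-> cmeas u.
Proof.
split=> [mu|[mr mi]].
  have part (h : Cx R -> R) : continuous h ->
      measurable_fun [set: T] (fun x => h (u x)).
    move=> hc; apply: (measurability _ (RGenOpens.measurableE R)).
    move=> _ [_ [a [b ->]] <-].
    have := mu measurableT (h @^-1` `]a, b[%classic); apply.
    by apply: sub_sigma_algebra; move/continuousP: hc; apply; exact: interval_open.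
  by split; apply: part; [exact: Re_cont | exact: Im_cont].
apply: (@measurability _ _ T (borel (Cx R)) setT u (@open (Cx R)) erefl).
move=> _ [U oU <-]; rewrite setTI.
pose sq (k : rat * rat * nat) (z : Cx R) : bool :=
  (`|complex.Re z - ratr k.1.1| < k.2.+1%:R^-1) &&
  (`|complex.Im z - ratr k.1.2| < k.2.+1%:R^-1).
have msq k : measurable [set x | sq k (u x)].
  rewrite -[X in measurable X]setTI; apply: measurable_and => //;
  apply: measurable_fun_ltr => //; apply: measurableT_comp => //;
  exact: measurable_funB.
have -> : u @^-1` U = \bigcup_k
    (if `[< [set z | sq k z] `<=` U >] then [set x | sq k (u x)] else set0).
  apply/seteqP; split=> [x /= Ux|x [k _]]; last first.
    by case: asboolP => // kU ?; exact: kU.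
  have /nbhs_ballP[[e0 e1] /= /andP[/eqP /= e10 e_gt0]] : nbhs (u x) U.
    by rewrite nbhsE; exists U => //; split.
  rewrite {}e10 {e1} => eU.
  have [m me] : exists m, m.+1%:R^-1 + m.+1%:R^-1 < e0 / 2.
    pose e := e0 / 4; have e_gt0' : 0 < e by rewrite divr_gt0.
    exists (Num.trunc e^-1).
    have := truncnS_gt e^-1; rewrite invf_plt ?posrE// => h.
    by rewrite (_ : e0 / 2 = e + e) ?ltrD// /e; field.
  have near (a : R) : exists r : rat, `|a - ratr r| < m.+1%:R^-1.
    have [|r] := @rat_in_itvoo R (a - m.+1%:R^-1) (a + m.+1%:R^-1).
      by rewrite ltrBlDr -addrA ltrDl addr_gt0 ?invr_gt0.
    by rewrite in_itv /= -ltr_distl distrC; exists r.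
  have [r1 h1] := near (complex.Re (u x)).
  have [r2 h2] := near (complex.Im (u x)).
  exists (r1, r2, m) => //; rewrite asboolT /=; first by apply/andP.
  move=> z /andP[/= z1 z2]; apply: eU; rewrite /ball /=.
  have close (a b r : R) : `|a - r| < m.+1%:R^-1 -> `|b - r| < m.+1%:R^-1 ->
      `|a - b| < e0 / 2.
    move=> ar br; apply: le_lt_trans me.
    rewrite (_ : a - b = (a - r) - (b - r)); last by ring.
    by apply: le_trans (ler_normB _ _) _; rewrite lerD ?ltW.
  have := @norm_cx_le _ (u x - z) (e0 / 2).
  rewrite -splitr; apply.
  - by have := close _ _ _ h1 z1; case: (u x) z {z1 z2} => a b [c0 d0].
  - by have := close _ _ _ h2 z2; case: (u x) z {z1 z2} => a b [c0 d0].
apply: countable_bigcupT_measurable; first exact: countableP.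
by move=> k; case: asboolP.
Qed.

End ComplexMeasurability.

(** * Approximation of the square root by polynomials *)

Section SquareRootIteration.
Local Open Scope sesquilinear_scope.
Local Open Scope complex_scope.
Context {R : realType}.

(** Only ring operations are used, so that the iteration applies to matrices and
    preserves measurability. *)
Definition sqrt_iter (t a : R) (k : nat) : R :=
  iter k (fun y => y + t * (a - y * y)) 0.

(** With r the square root of a, one step multiplies r - y by
    1 - t * (r + y), which lies between 0 and 1 - t * r as long as
    0 <= y <= r and t <= (2 * r)^-1. *)
Lemma sqrt_iter_cvg (a c : R) : 0 <= a -> 0 < c -> a <= c ^+ 2 ->
  sqrt_iter (2 * c)^-1 a @ \oo --> a `^ 2^-1.
Proof.
move=> a0 c0 ac; rewrite powR12_sqrt//; set t := (2 * c)^-1; set r := Num.sqrt a.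
have r0 : 0 <= r by exact: sqrtr_ge0.
have rr : r * r = a by rewrite -expr2 sqr_sqrtr.
have rc : r <= c by rewrite -(ger0_norm (ltW c0)) -sqrtr_sqr ler_wsqrtr.
have t0 : 0 < t by rewrite invr_gt0 mulr_gt0.
have tr1 : t * (2 * r) <= 1.
  by rewrite /t mulrC ler_pdivrMr ?mulr_gt0// mul1r ler_pM2l.
have tr0 : 0 <= t * r by exact: mulr_ge0 (ltW t0) r0.
have bounds k : [/\ 0 <= sqrt_iter t a k, sqrt_iter t a k <= r &
    r - sqrt_iter t a k <= r * (1 - t * r) ^+ k].
  elim: k => [|k [y0 yr ye]]; first by split; rewrite //= subr0 expr0 mulr1.
  rewrite [sqrt_iter _ _ k.+1]iterS -/(sqrt_iter t a k).
  move: (sqrt_iter t a k) y0 yr ye => y y0 yr ye.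
  have ty : t * y <= t * r by rewrite ler_pM2l.
  have ty0 : 0 <= t * y by exact: mulr_ge0 (ltW t0) y0.
  have E : r - (y + t * (a - y * y)) = (r - y) * (1 - t * (r + y)).
    by rewrite -rr; ring.
  have f0 : 0 <= 1 - t * (r + y) by lra.
  have f1 : 1 - t * (r + y) <= 1 - t * r by lra.
  have ry : 0 <= r - y by rewrite subr_ge0.
  have yy : y * y <= a by rewrite -rr ler_pM.
  split.
  - by rewrite addr_ge0// mulr_ge0 ?(ltW t0)// subr_ge0.
  - by rewrite -subr_ge0 E mulr_ge0.
  - by rewrite E exprSr mulrA ler_pM.
have err : (fun k => r * (1 - t * r) ^+ k) @ \oo --> (0 : R).
  have [->|rn0] := eqVneq r 0.
    by under eq_fun do rewrite mul0r; exact: cvg_cst.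
  apply: cvg_geometric; rewrite ger0_norm; last by lra.
  by rewrite ltrBlDr ltrDl mulr_gt0// lt_neqAle eq_sym rn0.
apply/cvgrPdist_le => e e0.
have /cvgrPdist_le/(_ _ e0) := err; apply: filterS => k.
have [_ yr ye] := bounds k; rewrite sub0r normrN => le.
rewrite ger0_norm ?subr_ge0//.
exact: le_trans ye (le_trans (ler_norm _) le).
Qed.

Context {n : nat}.
Implicit Types (P A : 'M[Cx R]_n).

Definition sqrtmx_iter (t : R) A (k : nat) : 'M[Cx R]_n :=
  iter k (fun Y => Y + (t%:C : Cx R) *: (A - Y *m Y)) 0.

Lemma sqrtmx_iter_udiag (t : R) P (a : 'I_n -> R) k : P \is unitarymx ->
  sqrtmx_iter t (udiag P a) k = udiag P (fun l => sqrt_iter t (a l) k).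
Proof.
move=> uP; elim: k => [|k IH].
  apply/matrixP => i j; rewrite udiagE [LHS]mxE big1// => l _.
  exact: mulr0.
rewrite [LHS]iterS -/(sqrtmx_iter t (udiag P a) k) IH (udiagM _ _ uP).
rewrite (udiagN P) [X in _ *: X](udiagD P a) (udiagZ P _ t) (udiagD P).
by congr (udiag P _); apply/funext => l; rewrite [RHS]iterS.
Qed.

Lemma udiag_cvg P (y : nat -> 'I_n -> R) (b : 'I_n -> R) i j :
  (forall l, y ^~ l @ \oo --> b l) ->
  (fun k => complex.Re (udiag P (y k) i j)) @ \oo -->
    (complex.Re (udiag P b i j) : R) /\
  (fun k => complex.Im (udiag P (y k) i j)) @ \oo -->
    (complex.Im (udiag P b i j) : R).
Proof.
move=> yb; pose w l : Cx R := ((P l i)^* * P l j)%R.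
have re (x : 'I_n -> R) :
    complex.Re (udiag P x i j) = \sum_l complex.Re (w l) * x l.
  rewrite udiagE Re_sum; apply: eq_bigr => l _.
  by rewrite cx_ReM /= mulr0 subr0.
have im (x : 'I_n -> R) :
    complex.Im (udiag P x i j) = \sum_l complex.Im (w l) * x l.
  rewrite udiagE Im_sum; apply: eq_bigr => l _.
  by rewrite cx_ImM /= mulr0 add0r.
split.
  under eq_fun do rewrite re.
  rewrite re; apply: cvg_big => //; first exact: add_continuous.
  by move=> l _; apply: cvgMr.
under eq_fun do rewrite im.
rewrite im; apply: cvg_big => //; first exact: add_continuous.
by move=> l _; apply: cvgMr.
Qed.

(** The step comes from the bound sqrt a <= 1 + \tr A, valid for every
    eigenvalue a of A. It depends on A through its trace only, hence measurably. *)
Lemma sqrtmx_iter_cvg A i j : psd A ->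
  let t := (2 * (1 + complex.Re (\tr A)))^-1 in
  (fun k => complex.Re (sqrtmx_iter t A k i j)) @ \oo -->
    (complex.Re (mxpow A 2^-1 i j) : R) /\
  (fun k => complex.Im (sqrtmx_iter t A k i j)) @ \oo -->
    (complex.Im (mxpow A 2^-1 i j) : R).
Proof.
move=> A0; have [P [a [uP a0 ->]]] := psd_udiagP A0.
rewrite (mxpow_udiag _ uP a0) (mxtrace_udiag _ uP) => t.
under [X in X @ _ --> _]eq_fun do rewrite (sqrtmx_iter_udiag _ _ _ uP).
under [X in _ /\ X @ _ --> _]eq_fun do rewrite (sqrtmx_iter_udiag _ _ _ uP).
apply: udiag_cvg => l; rewrite /t.
have tr_ge : a l <= \sum_m a m.
  by rewrite (bigD1 l)//= lerDl sumr_ge0.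
have := a0 l; set s := \sum_m _ in tr_ge *; move: (a l) tr_ge => b bs b0.
apply: sqrt_iter_cvg => //; first by lra.
have := sqr_ge0 s; rewrite (_ : (1 + s) ^+ 2 = 1 + 2 * s + s ^+ 2); last by ring.
lra.
Qed.

End SquareRootIteration.

(** * Measurability of matrix functions *)

Section MatrixMeasurability.
Local Open Scope sesquilinear_scope.
Local Open Scope complex_scope.
Context {R : realType} {d : measure_display} {T : measurableType d}.

Definition mxmeas m n (F : T -> 'M[Cx R]_(m, n)) : Prop :=
  forall i j, cmeas (fun x => F x i j).

Lemma mxmeas_cst m n (A : 'M[Cx R]_(m, n)) : mxmeas (fun=> A).
Proof. by move=> i j; exact: cmeas_cst. Qed.

Lemma mxmeasD m n (F G : T -> 'M[Cx R]_(m, n)) :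
  mxmeas F -> mxmeas G -> mxmeas (fun x => F x + G x).
Proof.
by move=> mF mG i j; under eq_fun do rewrite mxE; exact: cmeasD.
Qed.

Lemma mxmeasZ m n (c : T -> Cx R) (F : T -> 'M[Cx R]_(m, n)) :
  cmeas c -> mxmeas F -> mxmeas (fun x => c x *: F x).
Proof.
by move=> mc mF i j; under eq_fun do rewrite mxE; exact: cmeasM.
Qed.

Lemma mxmeasB m n (F G : T -> 'M[Cx R]_(m, n)) :
  mxmeas F -> mxmeas G -> mxmeas (fun x => F x - G x).
Proof.
move=> mF mG; apply: mxmeasD => //; under eq_fun do rewrite -scaleN1r.
by apply: mxmeasZ => //; exact: cmeas_cst.
Qed.

Lemma mxmeasM m n p (F : T -> 'M[Cx R]_(m, n)) (G : T -> 'M[Cx R]_(n, p)) :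
  mxmeas F -> mxmeas G -> mxmeas (fun x => F x *m G x).
Proof.
move=> mF mG i j; under eq_fun do rewrite mxE.
by apply: cmeas_sum => k; exact: cmeasM.
Qed.

Lemma mxmeas_adj m n (F : T -> 'M[Cx R]_(m, n)) :
  mxmeas F -> mxmeas (fun x => (F x) ^t*).
Proof.
move=> mF i j; under eq_fun do rewrite mxE mxE; exact: cmeas_conj.
Qed.

Lemma mxmeas_sum m n (I : Type) (s : seq I) (F : I -> T -> 'M[Cx R]_(m, n)) :
  (forall i, mxmeas (F i)) -> mxmeas (fun x => \sum_(i <- s) F i x).
Proof.
by move=> mF i j; under eq_fun do rewrite summxE; apply: cmeas_sum => k; exact: mF.
Qed.

Lemma mxmeas_trace n (F : T -> 'M[Cx R]_n) :
  mxmeas F -> cmeas (fun x => \tr (F x)).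
Proof. by move=> mF; apply: cmeas_sum => i; exact: mF. Qed.

Context {n : nat}.
Implicit Types F : T -> 'M[Cx R]_n.

Lemma mxmeas_sqrt_psd F : mxmeas F -> (forall x, psd (F x)) ->
  mxmeas (fun x => mxpow (F x) 2^-1).
Proof.
move=> mF F0; pose t x := (2 * (1 + complex.Re (\tr (F x))))^-1 : R.
have mt : measurable_fun [set: T] t.
  (* The inverse is a power, since the trace of a positive matrix is nonnegative. *)
  have tE x : t x = (2 * (1 + complex.Re (\tr (F x)))) `^ (- 1).
    rewrite powR_inv1//.
    have [P [a [uP a0 ->]]] := psd_udiagP (F0 x).
    by rewrite (mxtrace_udiag _ uP) mulr_ge0// addr_ge0// sumr_ge0.
  rewrite (funext tE).
  apply: (@measurableT_comp _ _ _ _ _ _ (fun r : R => r `^ (- 1))) => //.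
  apply: measurable_funM => //; apply: measurable_funD => //.
  by have [] := mxmeas_trace mF.
have mY k : mxmeas (fun x => sqrtmx_iter (t x) (F x) k).
  elim: k => [|k IH]; first exact: mxmeas_cst.
  apply: mxmeasD => //; apply: mxmeasZ; first exact: cmeas_real.
  by apply: mxmeasB => //; exact: mxmeasM.
move=> i j; split.
- apply: (measurable_fun_cvg (h := fun k x =>
    complex.Re (sqrtmx_iter (t x) (F x) k i j))) => [k|x _].
    by have [] := mY k i j.
  by have [] := sqrtmx_iter_cvg i j (F0 x).
- apply: (measurable_fun_cvg (h := fun k x =>
    complex.Im (sqrtmx_iter (t x) (F x) k i j))) => [k|x _].
    by have [] := mY k i j.
  by have [] := sqrtmx_iter_cvg i j (F0 x).
Qed.

(** The matrix A is positive exactly when it equals its absolute value, the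
    square root of A ^t* *m A. Absolute values are measurable and everywhere
    positive; this gives at once the measurability of the set where F is
    positive and of the square root there. *)
Lemma mxmeas_sqrt F : mxmeas F -> mxmeas (fun x => mxpow (F x) 2^-1).
Proof.
move=> mF; pose G x := mxpow ((F x) ^t* *m F x) 2^-1.
have mG : mxmeas G.
  apply: mxmeas_sqrt_psd => [|x]; last exact: psd_gram.
  by apply: mxmeasM => //; exact: mxmeas_adj.
have mS : mxmeas (fun x => mxpow (G x) 2^-1).
  by apply: mxmeas_sqrt_psd => // x; exact: mxpow_psd.
pose b (x : T) := [forall i, forall j,
  (complex.Re (F x i j) == complex.Re (G x i j)) &&
  (complex.Im (F x i j) == complex.Im (G x i j))].
have bP x : reflect (psd (F x)) (b x).
  apply: (iffP idP) => [bx|F0].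
    rewrite (_ : F x = G x); first exact: mxpow_psd.
    apply/matrixP => i j; move/forallP/(_ i)/forallP/(_ j) : bx.
    by case: (F x i j) (G x i j) => [? ?] [? ?] /= /andP[/eqP -> /eqP ->].
  by apply/forallP => i; apply/forallP => j; rewrite /G sqrt_psd_sqr ?eqxx.
have mb : measurable_fun [set: T] b.
  have forall_meas (h : 'I_n -> T -> bool) :
      (forall i, measurable_fun [set: T] (h i)) ->
      measurable_fun [set: T] (fun x => [forall i, h i x]).
    move=> mh; rewrite (_ : (fun x => _) =
        (fun x => \big[andb/true]_(i < n) h i x)); last first.
      by apply/funext => x; rewrite big_andE.
    elim: (index_enum _) => [|i s IH].
      by under eq_fun do rewrite big_nil; exact: measurable_cst.
    by under eq_fun do rewrite big_cons; exact: measurable_and.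
  apply: (forall_meas) => i; apply: (forall_meas) => j.
  have [[rF iF] [rG iG]] := (mF i j, mG i j).
  by apply: measurable_and; exact: measurable_fun_eqr.
have E x : mxpow (F x) 2^-1 = if b x then mxpow (G x) 2^-1 else 0.
  case: bP => [F0|nF]; first by rewrite /G sqrt_psd_sqr.
  by rewrite /mxpow asboolF.
move=> i j; under eq_fun do rewrite E.
have ite (p : 'M[Cx R]_n -> R) : p 0 = 0 ->
    measurable_fun [set: T] (fun x => p (mxpow (G x) 2^-1)) ->
    measurable_fun [set: T] (fun x => p (if b x then mxpow (G x) 2^-1 else 0)).
  move=> p0 mp; rewrite (_ : (fun x => _) =
      (fun x => if b x then p (mxpow (G x) 2^-1) else 0)); last first.
    by apply/funext => x; case: ifP.
  exact: measurable_fun_ifT.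
have [mr mi] := mS i j.
split; first by apply: (ite (fun A => complex.Re (A i j))); rewrite ?mxE.
by apply: (ite (fun A => complex.Im (A i j))); rewrite ?mxE.
Qed.

End MatrixMeasurability.

(** * Quantum random variables and their densities *)

Section QuantumRandomVariables.
Local Open Scope sesquilinear_scope.
Local Open Scope complex_scope.
Local Open Scope charge_scope.
Context {R : realType} {n : nat} {X : ptopologicalType}.
Implicit Types (f g h : borel X -> 'M[Cx R]_n).

(** Adding the state rho to A makes the trace positive; the sum is then a
    multiple of a state. *)
Lemma qrv_trace_psd (rho : state R n) f (A : 'M[Cx R]_n) : qrv f -> psd A ->
  cmeas (fun x => \tr (A *m f x)).
Proof.
move=> mf A0; have B0 := psdD A0 (state_psd rho).
pose tau : R := complex.Re (\tr A) + 1.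
have trB : \tr (A + rho) = tau%:C.
  rewrite mxtraceD state_tr (cx_ge0_real (psd_trace_ge0 A0)).
  by rewrite -real_cxD.
have tau0 : 0 < tau.
  by rewrite ltr_wpDl//; have /cx_ge0P[] := psd_trace_ge0 A0.
have ttV : ((tau^-1)%:C : Cx R) * tau%:C = 1.
  by rewrite -real_cxM mulVf ?gt_eqF.
have sp : psd (((tau^-1)%:C : Cx R) *: (A + rho)).
  by apply: psdZ => //; rewrite invr_ge0 ltW.
have st : \tr (((tau^-1)%:C : Cx R) *: (A + rho)) = 1.
  by rewrite mxtraceZ trB.
have /borel_cmeas mS := mf (State sp st).
have /borel_cmeas mrho := mf rho.
rewrite (_ : (fun x => _) = (fun x => (tau%:C : Cx R) *
    \tr ((State sp st) *m f x) + (-1 : Cx R) * \tr (rho *m f x))).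
  apply: cmeasD; first by apply: cmeasM => //; exact: cmeas_cst.
  by apply: cmeasM => //; exact: cmeas_cst.
apply/funext => x /=; rewrite -scalemxAl mxtraceZ mulrA.
rewrite [_%:C * _]mulrC ttV mul1r mulmxDl mxtraceD mulN1r.
by rewrite addrK.
Qed.

(** Quadratic forms are pairings with the rank-one positive matrices v v^*;
    polarization recovers the entries from them. *)
Lemma qrv_mxmeas (rho : state R n) f : qrv f -> mxmeas f.
Proof.
move=> mf.
have form_meas (v : 'cV[Cx R]_n) : cmeas (fun x => (v ^t* *m f x *m v) 0 0).
  have vv0 := psd_gram (v ^t*); rewrite trmxCK in vv0.
  rewrite (_ : (fun x => _) = (fun x => \tr (v *m v ^t* *m f x))).
    exact: qrv_trace_psd.
  by apply/funext => x; rewrite mxtrace_rank_one.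
move=> i j.
under eq_fun do rewrite polarization.
have mc (c : Cx R) (u : borel X -> Cx R) : cmeas u -> cmeas (fun x => c * u x).
  by move=> mu; apply: cmeasM => //; exact: cmeas_cst.
by apply: (mc); apply: cmeasD; last apply: (mc);
   apply: cmeasD => //; apply: (mc); exact: cmeasD.
Qed.

Lemma mxmeas_qrv f : mxmeas f -> qrv f.
Proof.
move=> mf s; apply/borel_cmeas; apply: mxmeas_trace.
by apply: mxmeasM => //; exact: mxmeas_cst.
Qed.

Context (nu : povm R n X) (rho : state R n).

Lemma LH_mxmeas f : LH nu rho f -> mxmeas f.
Proof.
move=> [m [c [h [mh fE]]]]; rewrite (funext fE).
apply: mxmeas_sum => k; apply: mxmeasZ; first exact: cmeas_cst.
by have [/(qrv_mxmeas rho)] := mh k.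
Qed.

Lemma ae_psd_LH f : mxmeas f -> ae_psd nu rho f -> LH nu rho f.
Proof.
move=> mf f0; exists 1%N, (fun=> 1), (fun=> f); split.
  by move=> _; split=> //; exact: mxmeas_qrv.
by move=> x; rewrite big_ord1 scale1r.
Qed.

(** Without absolute continuity the derivative is by convention a constant
    function. *)
Lemma measurable_Radon_Nikodym (d : measure_display) (T : measurableType d)
    (nu0 : {charge set T -> \bar R}) (mu : {sigma_finite_measure set T -> \bar R}) :
  measurable_fun [set: T] ('d nu0 '/d mu).
Proof.
have [numu|numu] := pselect (nu0 `<< mu).
  exact/measurable_int/Radon_Nikodym_integrable.
by rewrite /Radon_Nikodym; case: pselect => // _; exact: measurable_cst.
Qed.

Lemma mxmeas_RNmx : mxmeas (RNmx nu rho).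
Proof.
move=> i j; rewrite /RNmx; under eq_fun do rewrite mxE.
by split; apply: (@measurableT_comp _ _ _ _ _ _ (@fine R)) => //;
  exact: measurable_Radon_Nikodym.
Qed.

(** The real part loses nothing where f x is positive. *)
Definition density (s : state R n) f (x : borel X) : R :=
  complex.Re (qeval nu rho s f x).

Lemma measurable_density s f : mxmeas f -> measurable_fun setT (density s f).
Proof.
move=> mf; have mH := mxmeas_sqrt mxmeas_RNmx.
suff [] : cmeas (qeval nu rho s f) by [].
apply: mxmeas_trace; apply: mxmeasM => //; apply: mxmeasM => //.
by apply: mxmeasM => //; exact: mxmeas_cst.
Qed.

(** The density is the pairing of s with H (f x) H, where H is hermitian. *)
Lemma density_ge0 s f x : psd (f x) -> 0 <= density s f x.
Proof.
move=> f0; rewrite /density /qeval -!mulmxA.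
have H0 := mxpow_psd (RNmx nu rho x) 2^-1.
apply: psd_tr_ge0; rewrite {1}(psd_herm H0) mulmxA.
exact: psd_congr.
Qed.

Lemma densityD s f g x :
  density s (fun y => f y + g y) x = density s f x + density s g x.
Proof. by rewrite /density /qeval mulmxDr mulmxDl mxtraceD ReD. Qed.

Lemma densityZ s f (c : R) x :
  density s (fun y => (c%:C : Cx R) *: f y) x = c * density s f x.
Proof.
rewrite /density /qeval -scalemxAr -scalemxAl mxtraceZ cx_ReM.
by rewrite mul0r subr0.
Qed.

End QuantumRandomVariables.

(** * The norm of a positive function *)

Section NormOfPositive.
Local Open Scope sesquilinear_scope.
Local Open Scope complex_scope.
Context {R : realType} {n : nat} {X : ptopologicalType}.
Context (nu : povm R n X) (rho : state R n).
Implicit Types f g : borel X -> 'M[Cx R]_n.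

Lemma density_le (s : state R n) f g x : psd (g x - f x) ->
  density nu rho s f x <= density nu rho s g x.
Proof.
move=> gf; have := @density_ge0 _ _ _ nu rho s (fun y => g y - f y) x gf.
rewrite -(lerD2l (density nu rho s f x)) addr0 -densityD.
by rewrite /density /qeval [f x + _]addrC subrK.
Qed.

(** Almost everywhere nonnegative functions agree with their positive parts,
    which compare as nonnegative functions. *)
Lemma ae_le_integral (u w : borel X -> R) :
    measurable_fun [set: borel X] u -> measurable_fun [set: borel X] w ->
    {ae nurho nu rho, forall x, 0 <= u x} ->
    {ae nurho nu rho, forall x, u x <= w x} ->
  (\int[nurho nu rho]_x (u x)%:E <= \int[nurho nu rho]_x (w x)%:E)%E.
Proof.
move=> mu mw u0 uw.
have posE (k : borel X -> R) : measurable_fun [set: borel X] k ->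
    {ae nurho nu rho, forall x, 0 <= k x} ->
    (\int[nurho nu rho]_x (k x)%:E = \int[nurho nu rho]_x (Num.max (k x) 0)%:E)%E.
  move=> mk k0; apply: ae_eq_integral => //.
  - exact/measurable_EFinP.
  - by apply/measurable_EFinP; apply: measurable_maxr.
  - by apply: filterS k0 => x kx _; rewrite max_l.
have w0 : {ae nurho nu rho, forall x, 0 <= w x}.
  by apply: filterS2 u0 uw => x; exact: le_trans.
rewrite (posE u mu u0) (posE w mw w0).
apply: ae_ge0_le_integral => //.
- by move=> x _; rewrite lee_fin le_max lexx orbT.
- by apply/measurable_EFinP; apply: measurable_maxr.
- by move=> x _; rewrite lee_fin le_max lexx orbT.
- by apply/measurable_EFinP; apply: measurable_maxr.
apply: filterS uw => x ux _; rewrite lee_fin ge_max !le_max ux lexx.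
by rewrite orbT.
Qed.

(** The norm of f when f is positive, by [norm1_psd]. *)
Definition mass f : \bar R := ereal_sup
  [set (\int[nurho nu rho]_x (density nu rho s f x)%:E)%E
    | s in [set: state R n]].

Lemma integral_le_mass f (s : state R n) :
  (\int[nurho nu rho]_x (density nu rho s f x)%:E <= mass f)%E.
Proof. by apply: ereal_sup_ubound; exists s. Qed.

Lemma mass_le f g : mxmeas f -> mxmeas g -> ae_psd nu rho f ->
    {ae nurho nu rho, forall x, psd (g x - f x)} ->
  (mass f <= mass g)%E.
Proof.
move=> mf mg f0 fg; apply: ge_ereal_sup => _ [s _ <-].
apply: le_trans (integral_le_mass g s).
apply: ae_le_integral; [exact: measurable_density | exact: measurable_density | |].
- by apply: filterS f0 => x; exact: density_ge0.
- by apply: filterS fg => x; exact: density_le.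
Qed.

(** The decomposition (f, 0, 0, 0) attains the infimum: for every other one
    [psd_four_parts] bounds f by the sum of the four parts. *)
Lemma norm1_psd f : LH nu rho f -> ae_psd nu rho f -> norm1 nu rho f = mass f.
Proof.
move=> fL f0; apply/le_anti/andP; split.
  apply: ereal_inf_lbound; exists f, (fun=> 0), (fun=> 0), (fun=> 0).
  have z0 : ae_psd nu rho (fun=> 0 : 'M[Cx R]_n).
    by apply: aeW => x; exact: psd0.
  have zL : LH nu rho (fun=> 0 : 'M[Cx R]_n).
    by apply: ae_psd_LH => //; exact: mxmeas_cst.
  split.
    by split=> // x; rewrite subr0 subrr scaler0 addr0.
  have E : f = (fun y => f y + 0 + 0 + 0) by apply/funext => x; rewrite !addr0.
  rewrite [in LHS]E; reflexivity.
apply: le_ereal_inf_tmp => _ [f1 [f2 [f3 [f4 [[[L1 p1] [L2 p2] [L3 p3] [L4 p4] fE] ->]]]]].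
have m1 := LH_mxmeas L1; have m2 := LH_mxmeas L2.
have m3 := LH_mxmeas L3; have m4 := LH_mxmeas L4.
rewrite -[X in (_ <= X)%E]/(mass _).
apply: mass_le; [exact: LH_mxmeas fL | | exact: f0 | ].
- by apply: mxmeasD => //; apply: mxmeasD => //; exact: mxmeasD.
have p12 : {ae nurho nu rho, forall x, psd (f1 x) /\ psd (f2 x)}.
  by apply: filterS2 p1 p2 => x.
have p34 : {ae nurho nu rho, forall x, psd (f3 x) /\ psd (f4 x)}.
  by apply: filterS2 p3 p4 => x.
apply: filterS3 f0 p12 p34 => x h0 [h1 h2] [h3 h4].
exact (psd_four_parts h1 h2 h3 h4 (fE x) h0).
Qed.

Lemma mass_ge0 f : (forall x, psd (f x)) -> (0 <= mass f)%E.
Proof.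
move=> f0; apply: le_trans (integral_le_mass f rho).
by apply: integral_ge0 => x _; rewrite lee_fin density_ge0.
Qed.

End NormOfPositive.

(** * Hoelder's inequality *)

Lemma ge0_integral_lin (d : measure_display) (T : measurableType d)
    (R : realType) (mu : {measure set T -> \bar R}) (c1 c2 : R) (U V : T -> R) :
    0 <= c1 -> 0 <= c2 ->
    measurable_fun [set: T] U -> measurable_fun [set: T] V ->
    (forall x, 0 <= U x) -> (forall x, 0 <= V x) ->
  (\int[mu]_x (c1 * U x + c2 * V x)%:E =
   c1%:E * \int[mu]_x (U x)%:E + c2%:E * \int[mu]_x (V x)%:E)%E.
Proof.
move=> c10 c20 mU mV U0 V0; under eq_integral do rewrite EFinD !EFinM.
have mUE : measurable_fun [set: T] (fun x => (U x)%:E) by exact/measurable_EFinP.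
have mVE : measurable_fun [set: T] (fun x => (V x)%:E) by exact/measurable_EFinP.
rewrite ge0_integralD//; last 4 first.
- by move=> x _; rewrite -EFinM lee_fin mulr_ge0.
- by apply: emeasurable_funM => //; exact: measurable_cst.
- by move=> x _; rewrite -EFinM lee_fin mulr_ge0.
- by apply: emeasurable_funM => //; exact: measurable_cst.
by rewrite !ge0_integralZl// => x _; rewrite lee_fin.
Qed.

Lemma le_mul_addgt0 (R : realType) (x a b : R) : 0 <= a -> 0 <= b ->
  (forall e, 0 < e -> x <= (a + e) * (b + e)) -> x <= a * b.
Proof.
move=> a0 b0 h; apply/ler_addgt0Pr => d d0.
have c0 : 0 < a + b + 1 by lra.
pose e := Num.min 1 (d / (a + b + 1)).
have e0 : 0 < e by rewrite lt_min ltr01 divr_gt0.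
have e1 : e <= 1 by rewrite ge_min lexx.
have ed : e * (a + b + 1) <= d by rewrite -ler_pdivlMr// ge_min lexx orbT.
(* The product exceeds a b by e (a + b + e) <= e (a + b + 1) <= d. *)
apply: le_trans (h e e0) _.
have -> : (a + e) * (b + e) = a * b + e * (a + b + e) by ring.
rewrite lerD2l (le_trans _ ed)// ler_pM2l//; lra.
Qed.

(** Take for a and b the p-th and q-th roots of F and G, enlarged by e > 0
    because a root may vanish, and let e tend to 0. *)
Lemma hoelder_of_young (R : realType) (p q : R) (M F G : \bar R) :
    0 < p -> 0 < q -> (0 <= F < +oo)%E -> (0 <= G < +oo)%E ->
    (forall a b : R, 0 < a -> 0 < b -> (F <= (a `^ p)%:E)%E ->
      (G <= (b `^ q)%:E)%E -> (M <= (a * b)%:E)%E) ->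
  (M < +oo /\ M <= F `^ p^-1 * G `^ q^-1)%E.
Proof.
move=> p0 q0 /andP[].
case: F => [F| |]// F0 _ /andP[]; case: G => [G| |]// G0 _ young.
rewrite lee_fin in F0; rewrite lee_fin in G0.
have powK (r c e : R) : 0 < r -> 0 <= c -> 0 < e -> c <= (c `^ r^-1 + e) `^ r.
  move=> r0 c0 e0; rewrite -{1}(powRr1 c0) -(mulVf (lt0r_neq0 r0)) powRrM.
  apply: ge0_ler_powR; rewrite ?nnegrE ?powR_ge0 ?(ltW r0)//.
    by rewrite addr_ge0 ?powR_ge0 ?ltW.
  by rewrite lerDl ltW.
have bound e : 0 < e -> (M <= ((F `^ p^-1 + e) * (G `^ q^-1 + e))%:E)%E.
  by move=> e0; apply: young; rewrite ?lee_fin ?powK// ltr_wpDl ?powR_ge0.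
suff MFG : (M <= (F `^ p^-1 * G `^ q^-1)%:E)%E.
  by split; [exact: le_lt_trans MFG (ltry _) | rewrite EFinM in MFG].
case: M {young} bound => [m| |] bound.
- rewrite lee_fin; apply: (le_mul_addgt0 (powR_ge0 _ _) (powR_ge0 _ _)) => e e0.
  by have := bound e e0; rewrite lee_fin.
- by have := bound 1 ltr01.
- exact: leNye.
Qed.

Section OperatorHoelder.
Local Open Scope complex_scope.
Context {R : realType} {n : nat}.
Context {X : ptopologicalType} (nu : povm R n X) (rho : state R n).
Implicit Types f g : borel X -> 'M[Cx R]_n.

Lemma ae_psd_mxpow f (r : R) : ae_psd nu rho (fun x => mxpow (f x) r).
Proof. by apply: aeW => x; exact: mxpow_psd. Qed.

(** [psd_young] integrated: the weights of f^p and g^q are chosen so that they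
    contribute a b / p and a b / q. *)
Lemma mass_young (p q a b : R) f g : 1 < p -> 1 < q -> p^-1 + q^-1 = 1 ->
    0 < a -> 0 < b -> mxmeas f -> mxmeas g ->
    mxmeas (fun x => mxpow (f x) p) -> mxmeas (fun x => mxpow (g x) q) ->
    ae_psd nu rho f -> ae_psd nu rho g ->
    {ae nurho nu rho, forall x, f x *m g x = g x *m f x} ->
    (mass nu rho (fun x => mxpow (f x) p) <= (a `^ p)%:E)%E ->
    (mass nu rho (fun x => mxpow (g x) q) <= (b `^ q)%:E)%E ->
  (mass nu rho (fun x => f x *m g x) <= (a * b)%:E)%E.
Proof.
move=> p1 q1 pq a0 b0 mf mg mfp mgq f0 g0 fg Fa Gb.
have p0 : 0 < p by exact: lt_trans ltr01 p1.
have q0 : 0 < q by exact: lt_trans ltr01 q1.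
have ap : 0 < a `^ p by exact: powR_gt0.
have bq : 0 < b `^ q by exact: powR_gt0.
apply: ge_ereal_sup => _ [s _ <-].
set c1 := a * b * (p * a `^ p)^-1; set c2 := a * b * (q * b `^ q)^-1.
have c10 : 0 <= c1 by rewrite !mulr_ge0 ?invr_ge0 ?mulr_ge0 ?ltW.
have c20 : 0 <= c2 by rewrite !mulr_ge0 ?invr_ge0 ?mulr_ge0 ?ltW.
have mU := measurable_density nu rho s mfp.
have mV := measurable_density nu rho s mgq.
have U0 x : 0 <= density nu rho s (fun x => mxpow (f x) p) x.
  exact (density_ge0 nu rho s (mxpow_psd (f x) p)).
have V0 x : 0 <= density nu rho s (fun x => mxpow (g x) q) x.
  exact (density_ge0 nu rho s (mxpow_psd (g x) q)).
have fgE : {ae nurho nu rho, forall x, density nu rho s (fun x => f x *m g x) x <=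
    c1 * density nu rho s (fun x => mxpow (f x) p) x +
    c2 * density nu rho s (fun x => mxpow (g x) q) x}.
  apply: filterS3 f0 g0 fg => x fx gx fgx.
  rewrite -(densityZ nu rho s _ c1) -(densityZ nu rho s _ c2) -densityD.
  exact (density_le nu rho s (psd_young p1 q1 pq a0 b0 fx gx fgx)).
have fg1 : {ae nurho nu rho, forall x, 0 <= density nu rho s (fun x => f x *m g x) x}.
  apply: filterS3 f0 g0 fg => x fx gx fgx.
  exact (density_ge0 nu rho s (psd_mulmx_comm fx gx fgx)).
have Fs := le_trans (integral_le_mass nu rho _ s) Fa.
have Gs := le_trans (integral_le_mass nu rho _ s) Gb.
have mW := measurable_density nu rho s (mxmeasM mf mg).
move: (density nu rho s (fun x => mxpow (f x) p)) mU U0 fgE Fs => U mU U0 fgE Fs.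
move: (density nu rho s (fun x => mxpow (g x) q)) mV V0 fgE Gs => V mV V0 fgE Gs.
apply: le_trans (ae_le_integral mW _ fg1 fgE) _.
  by apply: measurable_funD; exact: measurable_funM.
rewrite (ge0_integral_lin (nurho nu rho) c10 c20 mU mV U0 V0).
apply: (@le_trans _ _ (c1%:E * (a `^ p)%:E + c2%:E * (b `^ q)%:E)%E).
  by apply: leeD; apply: lee_wpmul2l; rewrite ?lee_fin.
rewrite -!EFinM -EFinD lee_fin /c1 /c2.
have -> : a * b * (p * a `^ p)^-1 * a `^ p + a * b * (q * b `^ q)^-1 * b `^ q =
    a * b * (p^-1 + q^-1).
  by field; rewrite !gt_eqF.
by rewrite pq mulr1.
Qed.

End OperatorHoelder.

Theorem theorem4p1 (R : realType) (n : nat) (X : ptopologicalType)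
    (X_locally_compact : locally_compact [set: X])
    (X_hausdorff : hausdorff_space X)
    (nu : povm R n X) (rho : state R n) (rho_full_rank : \rank rho = n)
    (p q : R) (p_gt1 : 1 < p) (q_gt1 : 1 < q) (pq_conj : p^-1 + q^-1 = 1)
    (f g : borel X -> 'M[Cx R]_n)
    (f_LH : LH nu rho f) (g_LH : LH nu rho g)
    (fp_L1 : L1 nu rho (fun x => mxpow (f x) p))
    (gq_L1 : L1 nu rho (fun x => mxpow (g x) q))
    (f_ge0 : ae_psd nu rho f) (g_ge0 : ae_psd nu rho g)
    (fg_comm : {ae nurho nu rho, forall x, f x *m g x = g x *m f x}) :
  L1 nu rho (fun x => f x *m g x) /\
  (norm1 nu rho (fun x => f x *m g x)
   <= norm1 nu rho (fun x => mxpow (f x) p) `^ (p^-1)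
      * norm1 nu rho (fun x => mxpow (g x) q) `^ (q^-1))%E.
Proof.
have p0 : 0 < p by exact: lt_trans ltr01 p_gt1.
have q0 : 0 < q by exact: lt_trans ltr01 q_gt1.
have mf := LH_mxmeas f_LH; have mg := LH_mxmeas g_LH.
have fg0 : ae_psd nu rho (fun x => f x *m g x).
  by apply: filterS3 f_ge0 g_ge0 fg_comm => x; exact: psd_mulmx_comm.
have fgL : LH nu rho (fun x => f x *m g x).
  by apply: ae_psd_LH => //; exact: mxmeasM.
have [fpL fp_fin] := fp_L1; have [gqL gq_fin] := gq_L1.
have nfg := norm1_psd fgL fg0.
have nf := norm1_psd fpL (ae_psd_mxpow nu rho f p).
have ng := norm1_psd gqL (ae_psd_mxpow nu rho g q).
have F0 := mass_ge0 nu rho (fun x => mxpow_psd (f x) p).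
have G0 := mass_ge0 nu rho (fun x => mxpow_psd (g x) q).
pose proof (fun a b a0 b0 =>
  @mass_young R n X nu rho p q a b f g p_gt1 q_gt1 pq_conj a0 b0 mf mg
    (LH_mxmeas fpL) (LH_mxmeas gqL) f_ge0 g_ge0 fg_comm) as young.
rewrite -nf in F0.
rewrite -ng in G0.
rewrite -nfg -nf -ng in young.
have F1 : (0 <= norm1 nu rho (fun x => mxpow (f x) p) < +oo)%E.
  exact (introT andP (conj F0 fp_fin)).
have G1 : (0 <= norm1 nu rho (fun x => mxpow (g x) q) < +oo)%E.
  exact (introT andP (conj G0 gq_fin)).
have [fin le] := hoelder_of_young p0 q0 F1 G1 young.
exact (conj (conj fgL fin) le).
Qed.
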